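(* Let $\mathcal L=\mathcal L^h_{N,M}$, $\mathcal C=\mathcal C^h_N$, $\boldsymbol\tau:\mathcal L\to\mathcal C$ and $\boldsymbol\pi:{\rm Inv}(\mathcal L)\to{\rm Inv}(\mathcal C)$ be as in the context. For all $\lambda,\mu\in\mathbb C$, $\mathcal A,\mathcal B\in\mathcal L$ and $\mathcal C_1,\mathcal D\in{\rm Inv}(\mathcal L)$, $\boldsymbol\tau(\lambda\mathcal A+\mu\mathcal B)=\lambda\boldsymbol\tau(\mathcal A)+\mu\boldsymbol\tau(\mathcal B)$, $\boldsymbol\tau(\mathcal A\mathcal B)=\boldsymbol\tau(\mathcal B\mathcal A)$, $\boldsymbol\pi(\mathcal C_1\mathcal D)=\boldsymbol\pi(\mathcal C_1)\boldsymbol\pi(\mathcal D)$. Moreover $\boldsymbol\tau$ and $\boldsymbol\pi$ are continuous (with respect to $\|\cdot\|_{\mathcal L}$ and $\|\cdot\|_{\mathcal C}$), $\boldsymbol\pi(e^{\mathcal A})=e^{\boldsymbol\tau(\mathcal A)}$ for every $\mathcal A\in\mathcal L$, and the operator norm of $\boldsymbol\tau$ from $(\mathcal L,\|\cdot\|_{\mathcal L})$ to $(\mathcal C,\|\cdot\|_{\mathcal C})$ equals $M$.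
   Context: Let $N,M,p$ be positive integers and $h=1/p$. Let $I_N$ be the set of all subsets of $\{1,\dots,N\}$; for $\alpha\in I_N$, $|\alpha|$ is its cardinality and $\bar\alpha$ its complement. For $\mathbf x=(x_i)$ write $\mathbf x_\alpha=(x_i)_{i\in\alpha}\in[0,1)^{|\alpha|}$ (increasing indices). For disjoint $\alpha,\beta$, $\mathbf y_\beta\diamond\mathbf x_\alpha=\mathbf z_{\alpha\cup\beta}$ where $z_i=x_i$ for $i\in\alpha$ and $z_i=y_i$ for $i\in\beta$. Write $\langle f\rangle_\alpha=\int_{[0,1)^{|\alpha|}}f\,d\mathbf x_\alpha$, $\langle f\rangle_\emptyset=f$. Let $\chi^h_i$ be the indicator of $[i/p,(i+1)/p)$; a function on $[0,1)^R$ is $h$-staircase if it is a finite linear combination of $\prod_{j=1}^R\chi^h_{i_j}(y_j)$; a matrix function is $h$-staircase if all entries are. For an $h$-staircase $M\times M$ matrix function $\mathbf A(\mathbf k,\mathbf x_\alpha)$ on $[0,1)^N\times[0,1)^{|\alpha|}$, $\langle\mathbf A(\mathbf k,\mathbf x_\alpha)\cdot\rangle_\alpha$ is the operator on $L^2([0,1)^N,\mathbb C^M)$, $\mathbf u\mapsto\langle\mathbf A(\mathbf k,\mathbf x_\alpha)\mathbf u(\mathbf k_{\bar\alpha}\diamond\mathbf x_\alpha)\rangle_\alpha$. $\mathcal L$ is the set of all $\mathcal A=\sum_{\alpha\in I_N}\langle\mathbf A_\alpha(\mathbf k,\mathbf x_\alpha)\cdot\rangle_\alpha$ with $h$-staircase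 $\mathbf A_\alpha=(a_{i,j,\alpha})$ (the $\mathbf A_\alpha$ are uniquely determined by $\mathcal A$), with norm $\|\mathcal A\|_{\mathcal L}=\sum_\alpha\max_{(\mathbf k,\mathbf x_\alpha),i}\sum_j|a_{i,j,\alpha}|$; it is a Banach algebra under composition, so $e^{\mathcal A}=\sum_{n\ge0}\mathcal A^n/n!\in\mathcal L$. $\mathcal I$ is the identity. ${\rm Inv}(\mathcal L)$ is the set of elements of $\mathcal L$ invertible as bounded operators. Every $\mathcal A\in{\rm Inv}(\mathcal L)$ can be written uniquely (for a fixed chosen ordering of $I_N$ that is ascending, or descending, in $|\alpha|$) as a product $\mathcal A=\prod_{\alpha\in I_N}\mathcal G_\alpha$ in that order, where $\mathcal G_\emptyset=\mathbf G_\emptyset(\mathbf k)\cdot$ is multiplication by an invertible $h$-staircase matrix function and, for $\alpha\neq\emptyset$, $\mathcal G_\alpha=\mathcal I+\langle\mathbf G_\alpha(\mathbf k,\mathbf x_\alpha)\cdot\rangle_\alpha$ is invertible with $\mathbf G_\alpha$ $h$-staircase. $\mathcal C=\mathcal C^h_N$ is the set of tuples $\mathbf f=(f_\alpha)_{\alpha\in I_N}$ where $f_\alpha$ is a complex $h$-staircase function of $\mathbf k_{\bar\alpha}\in[0,1)^{N-|\alpha|}$ (a constant if $\alpha=\{1,\dots,N\}$); operations (sum, product, exponential) are componentwise and $\|\mathbf f\|_{\mathcal C}=\max_{\alpha,\mathbf k_{\bar\alpha}}|f_\alpha(\mathbf k_{\bar\alpha})|$. ${\rm Inv}(\mathcal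 C)$ is the set of $\mathbf f\in\mathcal C$ with no zeros. Trace: $\boldsymbol\tau(\mathcal A)=(\tau_\alpha(\mathcal A))_{\alpha}$, $\tau_\alpha(\mathcal A)(\mathbf k_{\bar\alpha})={\rm Tr}\langle\mathbf A_\alpha(\mathbf k_{\bar\alpha}\diamond\mathbf x_\alpha,\mathbf x_\alpha)\rangle_\alpha$ (matrix trace). Determinant: for $\mathcal A\in{\rm Inv}(\mathcal L)$ with factorization above (fixed ordering), $\boldsymbol\pi(\mathcal A)=(\pi_\alpha(\mathcal G_\alpha))_\alpha$ where $\pi_\emptyset(\mathcal G_\emptyset)(\mathbf k)=\det\mathbf G_\emptyset(\mathbf k)$ and, for $\alpha\ne\emptyset$ and fixed $\mathbf k_{\bar\alpha}$, $\pi_\alpha(\mathcal G_\alpha)(\mathbf k_{\bar\alpha})$ is the (Fredholm) determinant of the identity-plus-finite-rank operator $\mathcal I+\langle\mathbf G_\alpha(\mathbf k_{\bar\alpha}\diamond\mathbf k_\alpha,\mathbf x_\alpha)\cdot\rangle_\alpha$ acting on $L^2([0,1)^{|\alpha|},\mathbb C^M)$ in the variable $\mathbf k_\alpha$. *)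

(* Defs.v *)
From HB Require Import structures.
From mathcomp Require Import all_boot all_order all_algebra.
From mathcomp Require Import reals complex.
Set Implicit Arguments. Unset Strict Implicit. Unset Printing Implicit Defensive.
Import Order.TTheory GRing.Theory Num.Theory.
Local Open Scope ring_scope.

(* h-staircase functions, h = 1/p.  The cube [0,1)^N is cut into the p^N     *)
(* cells prod_j [i_j/p,(i_j+1)/p); an h-staircase function is exactly a      *)
(* function of the cell index, i.e. of an element of  cell N p.              *)
Definition cell (N p : nat) := {ffun 'I_N -> 'I_p}.

Definition merge (N : nat) (T : Type) (a : {set 'I_N}) (k x : {ffun 'I_N -> T})
  : {ffun 'I_N -> T} := [ffun i => if i \in a then x i else k i].

(* An element of L: the family alpha |-> A_alpha(k, x_alpha), where
   A a k x : 'M[C]_M is the value on the cell k (of the variable k in [0,1)^N)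
   and the cell x (whose coordinates in a give the cell of x_alpha).          *)
Definition Lfam (R : realType) (N M p : nat) :=
  {set 'I_N} -> cell N p -> cell N p -> 'M[R[i]]_M.

Definition wfL (R : realType) (N M p : nat) (A : Lfam R N M p) : Prop :=
  forall (a : {set 'I_N}) (k x x' : cell N p),
    (forall i, i \in a -> x i = x' i) -> A a k x = A a k x'.

Definition addL (R : realType) (N M p : nat) (A B : Lfam R N M p) : Lfam R N M p :=
  fun a k x => A a k x + B a k x.
Definition scaleL (R : realType) (N M p : nat) (c : R[i]) (A : Lfam R N M p)
  : Lfam R N M p := fun a k x => c *: A a k x.

Definition normL (R : realType) (N M p : nat) (A : Lfam R N M p) : R :=
  \sum_(a : {set 'I_N})
     \big[Num.max/0]_(k : cell N p) \big[Num.max/0]_(x : cell N p)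
       \big[Num.max/0]_(i < M) \sum_(j < M) Normc.normc (A a k x i j).

(* An element of C: alpha |-> f_alpha(k_{bar alpha}) (we store it as a function
   of the full cell k; all elements considered below depend on k_{bar a} only). *)
Definition Cfam (R : realType) (N p : nat) := {set 'I_N} -> cell N p -> R[i].

Definition normC (R : realType) (N p : nat) (f : Cfam R N p) : R :=
  \big[Num.max/0]_(a : {set 'I_N}) \big[Num.max/0]_(k : cell N p) Normc.normc (f a k).

(* Trace: tau_a(A)(k_{bar a}) = Tr < A_a(k_{bar a} <> x_a, x_a) >_a.
   For a staircase integrand the integral over [0,1)^N (of a function of x_a)
   is the average over the p^N cells. *)
Definition tauL (R : realType) (N M p : nat) (A : Lfam R N M p) : Cfam R N p :=
  fun a k => ((p ^ N)%:R)^-1 * \sum_(x : cell N p) \tr (A a (merge a k x) x).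

(* Operator semantics.  For q >= 1, fine N p q is the set of cells of the    *)
(* grid of mesh h/q (each h-cell split in q parts per coordinate); functions *)
(* on it are the h/q-staircase C^M-valued functions, a finite-dimensional    *)
(* subspace of L^2([0,1)^N, C^M) invariant under every operator of L; the    *)
(* union over q is dense in L^2.                                             *)
Definition fine (N p q : nat) := {ffun 'I_N -> ('I_p * 'I_q)%type}.
Definition coarse (N p q : nat) (g : fine N p q) : cell N p := [ffun i => (g i).1].
Definition vfun (R : realType) (N M p q : nat) := fine N p q -> 'cV[R[i]]_M.

Definition opL (R : realType) (N M p q : nat) (A : Lfam R N M p)
  (u : vfun R N M p q) : vfun R N M p q :=
  fun g => \sum_(a : {set 'I_N})
     (((p * q) ^ N)%:R)^-1 *:
       \sum_(y : fine N p q) (A a (coarse g) (coarse (merge a g y)) *m u (merge a g y)).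

Definition invL (R : realType) (N M p : nat) (A : Lfam R N M p) : Prop :=
  wfL A /\ forall q, (0 < q)%N -> bijective (@opL R N M p q A).

Definition valid_order (N : nat) (ord : seq {set 'I_N}) : Prop :=
  uniq ord /\ (forall a : {set 'I_N}, a \in ord) /\
  (sorted (fun a b : {set 'I_N} => (#|a| <= #|b|)%N) ord \/
   sorted (fun a b : {set 'I_N} => (#|b| <= #|a|)%N) ord).

(* the factor G_a as an element of L: G_emptyset(k) . for a = set0,
   I + < G_a(k,x_a) . >_a otherwise *)
Definition factorL (R : realType) (N M p : nat) (G : Lfam R N M p) (a : {set 'I_N})
  : Lfam R N M p :=
  fun b k x =>
    if a == set0 then (if b == set0 then G set0 k x else 0)
    else if b == set0 then 1%:M else if b == a then G a k x else 0.

Definition is_factorization (R : realType) (N M p : nat) (ord : seq {set 'I_N})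
  (A G : Lfam R N M p) : Prop :=
  wfL G /\
  (forall k x : cell N p, G set0 k x \in unitmx) /\
  (forall a : {set 'I_N}, a != set0 -> invL (factorL G a)) /\
  (forall q, (0 < q)%N -> forall (u : vfun R N M p q) g,
      @opL R N M p q A u g = foldr (fun a f => @opL R N M p q (factorL G a) \o f) id ord u g).

(* cells y of [0,1)^N with y_{bar a} = k_{bar a}, i.e. the cells of the variable k_a *)
Definition slice (N p : nat) (a : {set 'I_N}) (k : cell N p) :=
  {y : cell N p | [forall i, (i \notin a) ==> (y i == k i)]}.

(* Fredholm determinant of I + < G_a(k_{bar a} <> k_a, x_a) . >_a on
   L^2([0,1)^{|a|}, C^M): the operator is identity plus finite rank with range
   in the a-staircase functions, so its determinant is the determinant of its
   restriction to that finite-dimensional invariant subspace (basis: indicator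
   of a cell of the variable k_a times a unit vector of C^M). *)
Definition fredholm_det (R : realType) (N M p : nat) (G : Lfam R N M p)
  (a : {set 'I_N}) (k : cell N p) : R[i] :=
  let I := (slice a k * 'I_M)%type in
  \det (\matrix_(r < #|{: I}|, s < #|{: I}|)
          let: (y, i) := @enum_val I predT r in
          let: (y', j) := @enum_val I predT s in
          ((r == s)%:R + ((p ^ #|a|)%:R)^-1 * G a (val y) (val y') i j)).

Definition piL (R : realType) (N M p : nat) (G : Lfam R N M p) : Cfam R N p :=
  fun a k => if a == set0 then \det (G set0 k k) else fredholm_det G a k.

Definition cvgC (R : realType) (s : nat -> R[i]) (l : R[i]) : Prop :=
  forall e : R, 0 < e -> exists n0, forall n, (n0 <= n)%N -> Normc.normc (s n - l) < e.

Definition is_expC (R : realType) (z w : R[i]) : Prop :=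
  cvgC (fun n => \sum_(m < n) z ^+ m / (m`!)%:R) w.

Definition is_expL (R : realType) (N M p : nat) (A E : Lfam R N M p) : Prop :=
  wfL E /\
  forall q, (0 < q)%N -> forall (u : vfun R N M p q) (g : fine N p q) (i : 'I_M),
    cvgC (fun n => (\sum_(m < n) ((m`!)%:R)^-1 *: iter m (@opL R N M p q A) u g) i ord0)
         (@opL R N M p q E u g i ord0).

(* Main.v *)
(* Inside each h-cell, split a function of one variable into its mean and its
   mean-zero part.  Fix the set b of coordinates in which a vector function is
   constant inside the cells, the other coordinates being mean-zero (one 2-fold
   refinement of the grid, with the sign function, suffices to see this).  On
   such functions an element A of L acts through the terms A_a with a included
   in b only, as a matrix T_b(A) over the cells which is block diagonal in the
   parameter k off b.  So A |-> T_b(A)(k) is multiplicative, and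
   D_b(A)(k) = det T_b(A)(k), t_b(A)(k) = tr T_b(A)(k) satisfy
     D_b(A)(k) = prod_(a <= b) prod_y pi_a(A)(y),
     t_b(A)(k) = sum_(a <= b) sum_y tau_a(A)(y),
   where y runs over the cells that agree with k off b \ a.  The factor with
   a = b is pi_b(A)(k), resp. tau_b(A)(k), so each property of pi and tau follows
   from the one of the determinant and the trace by induction on b; in
   particular the ordering of the factorization plays no role. *)

Require Import Defs.
From HB Require Import structures.
From mathcomp Require Import all_classical topology normedtype sequences exp.
From mathcomp Require Import all_boot all_order all_algebra.
From mathcomp Require Import reals complex.
From mathcomp Require Import ring.
Set Implicit Arguments. Unset Strict Implicit. Unset Printing Implicit Defensive.
Import Order.TTheory GRing.Theory Num.Theory numFieldNormedType.Exports.
Local Open Scope ring_scope.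

(** * Convergence along a filter in a numeric field *)

Section Tends.
Variables (K : numFieldType) (X : Type) (F : set_system X).
Implicit Types (f g : X -> K) (l m : K).

Definition tends f l := forall e, 0 < e -> F (fun x => `|f x - l| < e).

Context {FF : Filter F}.

Lemma tends_cvg f l : tends f l <-> (f @ F --> l)%classic.
Proof.
split.
  move=> h; apply/(@cvgrPdist_lt K K) => e e0; apply: filterS (h e e0) => x.
  by rewrite distrC.
move/(@cvgrPdist_lt K K) => h e e0; apply: filterS (h e e0) => x.
by rewrite distrC.
Qed.

Lemma tends_cst l : tends (fun=> l) l.
Proof. by apply/tends_cvg; exact: cvg_cst. Qed.

Lemma eq_tends f g l : f =1 g -> tends f l -> tends g l.
Proof. by move=> fg h e /h; apply: filterS => x; rewrite fg. Qed.

Lemma tendsD f g l m : tends f l -> tends g m -> tends (fun x => f x + g x) (l + m).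
Proof. by move=> /tends_cvg fl /tends_cvg gm; apply/tends_cvg; exact: cvgD. Qed.

Lemma tendsM f g l m : tends f l -> tends g m -> tends (fun x => f x * g x) (l * m).
Proof. by move=> /tends_cvg fl /tends_cvg gm; apply/tends_cvg; exact: cvgM. Qed.

Lemma tendsV f l : l != 0 -> tends f l -> tends (fun x => (f x)^-1) l^-1.
Proof. by move=> l0 /tends_cvg fl; apply/tends_cvg; exact: cvgV. Qed.

Lemma tends_sum I (r : seq I) (P : pred I) (f : I -> X -> K) (l : I -> K) :
  (forall i, P i -> tends (f i) (l i)) ->
  tends (fun x => \sum_(i <- r | P i) f i x) (\sum_(i <- r | P i) l i).
Proof.
move=> h; elim: r => [|i r IH].
  by rewrite big_nil; apply: eq_tends (tends_cst 0) => x; rewrite big_nil.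
rewrite big_cons; case: ifPn => Pi; last first.
  by apply: eq_tends IH => x; rewrite big_cons (negPf Pi).
by apply: eq_tends (tendsD (h i Pi) IH) => x; rewrite big_cons Pi.
Qed.

Lemma tends_prod I (r : seq I) (P : pred I) (f : I -> X -> K) (l : I -> K) :
  (forall i, P i -> tends (f i) (l i)) ->
  tends (fun x => \prod_(i <- r | P i) f i x) (\prod_(i <- r | P i) l i).
Proof.
move=> h; elim: r => [|i r IH].
  by rewrite big_nil; apply: eq_tends (tends_cst 1) => x; rewrite big_nil.
rewrite big_cons; case: ifPn => Pi; last first.
  by apply: eq_tends IH => x; rewrite big_cons (negPf Pi).
by apply: eq_tends (tendsM (h i Pi) IH) => x; rewrite big_cons Pi.
Qed.

Lemma tends_mulmx a b c (A : X -> 'M[K]_(a, b)) (B : X -> 'M[K]_(b, c))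
  (A0 : 'M_(a, b)) (B0 : 'M_(b, c)) :
  (forall i j, tends (fun x => A x i j) (A0 i j)) ->
  (forall i j, tends (fun x => B x i j) (B0 i j)) ->
  forall i j, tends (fun x => (A x *m B x) i j) ((A0 *m B0) i j).
Proof.
move=> hA hB i j; rewrite mxE.
apply: eq_tends (tends_sum _ (fun k _ => tendsM (hA i k) (hB k j))) => x.
by rewrite mxE.
Qed.

Lemma tends_det n (A : X -> 'M[K]_n) (A0 : 'M_n) :
  (forall i j, tends (fun x => A x i j) (A0 i j)) ->
  tends (fun x => \det (A x)) (\det A0).
Proof.
move=> hA; apply: tends_sum => s _; apply: tendsM; first exact: tends_cst.
by apply: tends_prod => i _; exact: hA.
Qed.

Lemma tends_unique {FP : ProperFilter F} f l m : tends f l -> tends f m -> l = m.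
Proof.
move=> /tends_cvg fl /tends_cvg fm.
exact: (cvg_unique (F := (f @ F)%classic) (@norm_hausdorff K K) fl fm).
Qed.

End Tends.

(** A positive element of [R[i]] has zero imaginary part, so the radii allowed in [tends] are
    exactly the real ones. *)
Lemma tends_normc (R : realType) X (F : set_system X) {FF : Filter F}
    (f : X -> R[i]) (l : R[i]) :
  tends F f l <-> forall e : R, 0 < e -> F (fun x => Normc.normc (f x - l) < e).
Proof.
split=> h e e0.
  by apply: filterS (h e%:C%C _) => [x|]; rewrite ltcR.
have eE : e = (complex.Re e)%:C%C.
  by case: e e0 => u v; rewrite ltcE /= => /andP[/eqP ->].
have re0 : 0 < complex.Re e by move: e0; rewrite eE ltcR.
by apply: filterS (h _ re0) => x; rewrite eE ltcR.
Qed.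

(** * Partial sums of the exponential series *)

Section ExpSeries.

Definition exp_sum (K : fieldType) (z : K) (n : nat) : K :=
  \sum_(0 <= m < n) z ^+ m / (m`!)%:R.

(* The right-hand side is dominated by its value at [`|a|] and [`|b|], which
   tends to 0 by the addition formula for the real exponential. *)
Lemma exp_sumD (K : numFieldType) (a b : K) n :
  exp_sum a n * exp_sum b n - exp_sum (a + b) n
  = \sum_(0 <= i < n) \sum_(n - i <= j < n)
      (a ^+ i / (i`!)%:R) * (b ^+ j / (j`!)%:R).
Proof.
pose c i j := (a ^+ i / (i`!)%:R) * (b ^+ j / (j`!)%:R).
(* The binomial theorem spreads [exp_sum (a + b) n] over the pairs with [i + j < n]; passing from
   [n] to [n.+1] adds the antidiagonal [i + j = n]. *)
have -> : exp_sum (a + b) n = \sum_(0 <= i < n) \sum_(0 <= j < n - i) c i j.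
  elim: n => [|n IH]; first by rewrite /exp_sum !big_geq.
  rewrite /exp_sum big_nat_recr //= -/(exp_sum _ _) IH.
  rewrite [RHS]big_nat_recr //= subSnn big_nat1.
  rewrite [X in _ = X + _](eq_big_nat _ _ (F2 := fun i =>
      \sum_(0 <= j < n - i) c i j + c i (n - i)%N)); last first.
    by move=> i /andP[_ ltin]; rewrite subSn 1?ltnW // big_nat_recr.
  rewrite big_split /= -addrA; congr (_ + _).
  have -> : c n 0 = c n (n - n)%N by rewrite subnn.
  rewrite -(big_nat_recr n 0 (fun i => c i (n - i)%N)) // big_mkord.
  rewrite [_ + b]addrC exprDn mulr_suml; apply: eq_bigr => i _.
  have le_in : (i <= n)%N by rewrite -ltnS.
  have nz m : (m`!)%:R != 0 :> K by rewrite pnatr_eq0 -lt0n fact_gt0.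
  have bz : ('C(n, i))%:R != 0 :> K by rewrite pnatr_eq0 -lt0n bin_gt0.
  rewrite /c -(bin_fact le_in) -[_ *+ 'C(n, i)]mulr_natr !natrM; field.
  by rewrite bz !nz.
rewrite /exp_sum big_distrl /= -sumrB; apply: eq_big_nat => i /andP[_ lt_in].
rewrite big_distrr /= (@big_cat_nat _ _ _ (n - i)%N 0 n) ?leq_subr //=.
by rewrite addrAC subrr add0r.
Qed.

Lemma tends_exp_sumD (R : realType) (a b : R[i]) :
  tends \oo%classic (fun n => exp_sum a n * exp_sum b n - exp_sum (a + b) n) 0.
Proof.
pose x := Normc.normc a; pose y := Normc.normc b.
have ha : `|a| = x%:C%C by []; have hb : `|b| = y%:C%C by [].
have hr : tends \oo%classic
    (fun n => exp_sum x n * exp_sum y n - exp_sum (x + y) n) 0.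
  have ex (z : R) : tends \oo%classic (exp_sum z) (expR z).
    by apply/tends_cvg; exact: is_cvg_series_exp_coeff.
  have h : tends \oo%classic
      (fun n => exp_sum x n * exp_sum y n + -1 * exp_sum (x + y) n)
      (expR x * expR y + -1 * expR (x + y)).
    by apply: tendsD; apply: tendsM => //; exact: tends_cst.
  rewrite expRD mulN1r subrr in h.
  by apply: eq_tends h => n; rewrite mulN1r.
apply/tends_normc => e e0; apply: filterS (hr _ e0) => n; rewrite !subr0 => hn.
rewrite -ltcR -[X in X < _]/(`|exp_sum a n * exp_sum b n - exp_sum (a + b) n|).
apply: le_lt_trans (_ : (exp_sum x n * exp_sum y n - exp_sum (x + y) n)%:C%C < _).
  rewrite !exp_sumD raddf_sum /= (le_trans (ler_norm_sum _ _ _)) //.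
  apply: ler_sum => i _; rewrite raddf_sum /= (le_trans (ler_norm_sum _ _ _)) //.
  apply: ler_sum => j _.
  by rewrite !rmorphM !fmorphV !rmorphXn !rmorph_nat /= -ha -hb !normrM !normfV
    !normrX !normr_nat.
by rewrite ltcR (le_lt_trans (ler_norm _) hn).
Qed.

End ExpSeries.

(** * The determinant of a matrix exponential *)

Section DetExp.
Variable R : realType.
Local Notation C := R[i].
Local Notation cvg_seq := (tends (\oo)%classic).

Lemma exp_sum_addl (a b : C) u v :
  cvg_seq (exp_sum a) u -> cvg_seq (exp_sum b) v ->
  cvg_seq (exp_sum (a + b)) (u * v).
Proof.
move=> au bv; have h : cvg_seq (fun n => exp_sum a n * exp_sum b n
    + -1 * (exp_sum a n * exp_sum b n - exp_sum (a + b) n)) (u * v + -1 * 0).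
  apply: tendsD; first exact: tendsM.
  by apply: tendsM; [exact: tends_cst | exact: tends_exp_sumD].
rewrite mulr0 addr0 in h.
by apply: eq_tends h => n; rewrite mulN1r opprB addrC subrK.
Qed.

(* The convergence of [exp_sum a] is deduced, not assumed: it is the quotient
   of two convergent sequences up to a null sequence. *)
Lemma exp_sum_cancelr (a b : C) u v : v != 0 ->
  cvg_seq (exp_sum (a + b)) u -> cvg_seq (exp_sum b) v ->
  cvg_seq (exp_sum a) (u / v).
Proof.
move=> v0 abu bv.
have prod : cvg_seq (fun n => exp_sum a n * exp_sum b n) u.
  have h : cvg_seq (fun n => (exp_sum a n * exp_sum b n - exp_sum (a + b) n)
      + exp_sum (a + b) n) (0 + u) by apply: tendsD => //; exact: tends_exp_sumD.
  rewrite add0r in h.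
  by apply: eq_tends h => n; rewrite subrK.
have h : cvg_seq (fun n => exp_sum a n * exp_sum b n * (exp_sum b n)^-1) (u / v).
  by apply: tendsM => //; exact: tendsV.
(* Eventually [exp_sum b n] lies within [|v|] of [v], hence is not 0; only for such [n] can it be
   cancelled. *)
have bn0 : (\oo)%classic (fun n => exp_sum b n != 0).
  apply: filterS (bv `|v| _) => [n|]; last by rewrite normr_gt0.
  by apply: contraTneq => ->; rewrite sub0r normrN ltxx.
move=> e e0; have he := h e e0.
by near=> n; rewrite -[exp_sum a n](mulfK (_ : exp_sum b n != 0)); near: n.
Unshelve. all: by end_near.
Qed.

Lemma exp_sum0 : cvg_seq (exp_sum (0 : C)) 1.
Proof.
move=> e e0; exists 1%N => // n /= n1.
rewrite /exp_sum big_ltn // big_nat big1 ?addr0 ?expr0 ?fact0 ?divr1 ?subrr ?normr0 //.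
by move=> [//|m] _; rewrite expr0n mul0r.
Qed.

Lemma exp_sum_sum I (r : seq I) (P : pred I) (z w : I -> C) :
  (forall i, P i -> cvg_seq (exp_sum (z i)) (w i)) ->
  cvg_seq (exp_sum (\sum_(i <- r | P i) z i)) (\prod_(i <- r | P i) w i).
Proof.
move=> h; elim: r => [|i r IH]; first by rewrite !big_nil; exact: exp_sum0.
by rewrite !big_cons; case: ifPn => // /h hi; exact: exp_sum_addl.
Qed.

Definition mx_exp_sum n (A : 'M[C]_n) k : 'M[C]_n :=
  \sum_(0 <= m < k) (m`!)%:R^-1 *: A ^+ m.

Lemma trig_mx_exp n (T : 'M[C]_n) m : (forall i j : 'I_n, (i < j)%N -> T i j = 0) ->
  (forall i j : 'I_n, (i < j)%N -> (T ^+ m) i j = 0)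
  /\ forall i, (T ^+ m) i i = T i i ^+ m.
Proof.
move=> trT; elim: m => [|m [IH1 IH2]].
  by split=> [i j ij|i]; rewrite expr0 mxE ?eqxx // -val_eqE /= ltn_eqF.
rewrite exprS; split=> [i j ij|i]; rewrite mxE.
  apply: big1 => k _; case: (ltnP i k) => [/trT ->|ki]; first by rewrite mul0r.
  by rewrite IH1 ?mulr0 // (leq_ltn_trans ki).
rewrite (bigD1 i) //= IH2 big1 ?addr0 ?exprS // => k ki.
case: (ltngtP i k) => [/trT ->|/IH1 ->|/val_inj ik]; rewrite ?mul0r ?mulr0 //.
by rewrite ik eqxx in ki.
Qed.

(* Schur triangularization reduces to the diagonal entries. *)
Lemma det_mx_exp n (A E : 'M[C]_n) :
  (forall i j, cvg_seq (fun k => mx_exp_sum A k i j) (E i j)) ->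
  cvg_seq (exp_sum (\tr A)) (\det E).
Proof.
case: n A E => [A E _|n A E AE].
  by rewrite det_mx00 /mxtrace big_ord0; exact: exp_sum0.
have [P /unitarymx_unit Pu trigA] := Schur A (ltn0Sn n).
set T := conjmx P A; have /is_trig_mxP trT : is_trig_mx T by [].
have TE : T = P *m A *m invmx P by rewrite /T conjumx.
have expT m : T ^+ m = P *m (A ^+ m) *m invmx P.
  elim: m => [|m IH]; first by rewrite !expr0 mulmx1 mulmxV.
  by rewrite !exprS IH TE -!mulmxE !mulmxA mulmxKV.
have sumT k : mx_exp_sum T k = P *m mx_exp_sum A k *m invmx P.
  rewrite /mx_exp_sum mulmx_sumr mulmx_suml; apply: eq_bigr => m _.
  by rewrite expT -scalemxAr -scalemxAl.
pose E' := P *m E *m invmx P.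
have TE' i j : cvg_seq (fun k => mx_exp_sum T k i j) (E' i j).
  have h : cvg_seq (fun k => (P *m mx_exp_sum A k *m invmx P) i j) (E' i j).
    move: i j; apply: tends_mulmx => i j; last exact: tends_cst.
    by move: i j; apply: tends_mulmx => i j //; exact: tends_cst.
  by apply: eq_tends h => k; rewrite sumT.
(* [E'] is an entrywise limit of triangular matrices, so its determinant is the product of its
   diagonal entries, each a scalar exponential. *)
have trigE : is_trig_mx E'.
  apply/is_trig_mxP => i j ij; apply: tends_unique (TE' i j) _.
  apply: eq_tends (tends_cst 0) => k; rewrite summxE big1 // => m _.
  by rewrite mxE (proj1 (trig_mx_exp m trT)) ?mulr0.
have -> : \det E = \prod_i E' i i.
  by rewrite -det_trig // !det_mulmx det_inv mulrAC divff ?mul1r // -unitfE -unitmxE.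
have -> : \tr A = \sum_i T i i.
  by rewrite -/(\tr T) TE mxtrace_mulC mulmxA mulVmx // mul1mx.
apply: exp_sum_sum => i _; apply: eq_tends (TE' i i) => k.
rewrite summxE; apply: eq_bigr => m _.
by rewrite mxE (proj2 (trig_mx_exp m trT)) mulrC.
Qed.

End DetExp.

(** * Determinants of kernels on a finite set *)

Section Kernels.
Variable C : fieldType.

(** Sylvester's identity: one block matrix factors both as lower times upper and as upper times
    lower triangular. *)
Lemma det_add1_mulmxC m n (X : 'M[C]_(m, n)) (Y : 'M[C]_(n, m)) :
  \det (1%:M + X *m Y) = \det (1%:M + Y *m X).
Proof.
transitivity (\det (block_mx 1%:M (- Y) X 1%:M)).
  have -> : block_mx 1%:M (- Y) X 1%:M =
      block_mx 1%:M 0 X 1%:M *m block_mx 1%:M (- Y) 0 (1%:M + X *m Y).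
    rewrite mulmx_block !mul1mx !mulmx1 !mul0mx !addr0 mulmxN.
    by rewrite addrCA addNr addr0.
  by rewrite det_mulmx det_lblock det_ublock !det1 !mul1r.
have -> : block_mx 1%:M (- Y) X 1%:M =
    block_mx 1%:M (- Y) 0 1%:M *m block_mx (1%:M + Y *m X) 0 X 1%:M.
  rewrite mulmx_block !mul1mx !mulmx1 !mul0mx !add0r mulNmx.
  by rewrite addrK.
by rewrite det_mulmx det_lblock det_ublock !det1 !mul1r mulr1.
Qed.

(** [A - 1] lives on the rows in the image of [f], so it factors through the inclusion matrix [E];
    Sylvester's identity then moves the determinant to size [m]. *)
Lemma det_mxsub_inj m n (f : 'I_m -> 'I_n) (A : 'M[C]_n) : injective f ->
  (forall i, i \notin codom f -> forall j, A i j = (i == j)%:R) ->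
  \det A = \det (mxsub f f A).
Proof.
move=> f_inj hA; pose E : 'M[C]_(n, m) := \matrix_(i, j) (i == f j)%:R.
have mulE p (B : 'M[C]_(p, n)) i j : (B *m E) i j = B i (f j).
  rewrite mxE (bigD1 (f j)) //= mxE eqxx mulr1 big1 ?addr0 // => k kf.
  by rewrite mxE (negPf kf) mulr0.
have mulET p (B : 'M[C]_(n, p)) i j : (E^T *m B) i j = B (f i) j.
  rewrite mxE (bigD1 (f i)) //= !mxE eqxx mul1r big1 ?addr0 // => k kf.
  by rewrite !mxE (negPf kf) mul0r.
have eqA : A = 1%:M + E *m (E^T *m (A - 1%:M)).
  apply/matrixP => i j; rewrite !mxE.
  have [/codomP[k ->]|iNf] := boolP (i \in codom f).
    rewrite (bigD1 k) //= mulET !mxE eqxx mul1r big1 ?addr0 ?subrKC // => l lk.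
    by rewrite !mxE inj_eq // eq_sym (negPf lk) mul0r.
  rewrite big1 ?addr0 ?hA // => k _; rewrite !mxE.
  by case: eqP iNf => [->|]; rewrite ?codom_f ?mul0r.
rewrite {1}eqA det_add1_mulmxC; congr (\det _); apply/matrixP => i j.
by rewrite 2!mxE mulE mulET !mxE inj_eq // subrKC.
Qed.

Variable T : finType.
Implicit Types (F G : T -> T -> C) (P : pred T).

Definition kmul F G (x y : T) := \sum_z F x z * G z y.

Definition kdet F := \det (\matrix_(r < #|T|, s < #|T|) F (enum_val r) (enum_val s)).

(** Identity rows off [P] turn the determinant of a diagonal block into that of a kernel on all of
    [T], so blocks of different shapes can be multiplied within one type. *)
Definition kmask P F (x y : T) := if P x then F x y else (x == y)%:R.

Lemma eq_kdet F G : F =2 G -> kdet F = kdet G.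
Proof. by move=> FG; congr (\det _); apply/matrixP => r s; rewrite !mxE FG. Qed.

Lemma kdet_mul F G : kdet (kmul F G) = kdet F * kdet G.
Proof.
rewrite -det_mulmx; congr (\det _); apply/matrixP => r s; rewrite !mxE.
rewrite /kmul (big_enum_val (A := T)) /=.
by apply: eq_bigr => k _; rewrite !mxE.
Qed.

Lemma kdet_id : kdet (fun x y => (x == y)%:R) = 1.
Proof.
rewrite -[RHS](det1 C #|T|); congr (\det _); apply/matrixP => r s; rewrite !mxE.
by rewrite (inj_eq enum_val_inj).
Qed.

Lemma sum_delta (x : T) (f : T -> C) : \sum_z (x == z)%:R * f z = f x.
Proof.
rewrite (bigD1 x) //= eqxx mul1r big1 ?addr0 // => z zx.
by rewrite eq_sym (negPf zx) mul0r.
Qed.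

(** A row of [F] in [P] only meets rows of [G] in [P], which the mask leaves intact; hence masking
    commutes with the product. *)
Lemma kdet_mask_mul P F G : (forall x y, P x -> ~~ P y -> F x y = 0) ->
  kdet (kmask P (kmul F G)) = kdet (kmask P F) * kdet (kmask P G).
Proof.
move=> F0; rewrite -kdet_mul; apply: eq_kdet => x y; rewrite /kmul /kmask.
case: ifP => Px; last by rewrite sum_delta Px.
apply: eq_bigr => z _; case: ifPn => // Pz.
by rewrite F0 // !mul0r.
Qed.

(** [F] is block diagonal along the fibres of [key], so the masks of two disjoint sets of keys
    multiply to the mask of their union. *)
Lemma kdet_mask_key (J : eqType) (key : T -> J) (s : seq J) F : uniq s ->
  (forall x y, key x != key y -> F x y = 0) ->
  kdet (kmask (fun x => key x \in s) F) =
  \prod_(j <- s) kdet (kmask (fun x => key x == j) F).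
Proof.
move=> + F0; elim: s => [_|j s IH /= /andP[js us]].
  by rewrite big_nil -kdet_id; apply: eq_kdet => x y; rewrite /kmask.
rewrite big_cons -IH // -kdet_mul; apply: eq_kdet => x y; rewrite /kmul /kmask.
rewrite inE; case: eqP => /= [kx|_]; last by rewrite sum_delta.
transitivity (\sum_z (y == z)%:R * F x z); first by rewrite sum_delta.
apply: eq_bigr => z _; have [kz|kz] := eqVneq (key x) (key z); last first.
  by rewrite F0 // mulr0 mul0r.
by rewrite -kz kx (negPf js) mulrC eq_sym.
Qed.

Lemma kdet_mask_sub m (f : 'I_m -> T) P F : injective f -> P =1 [in codom f] ->
  kdet (kmask P F) = \det (\matrix_(i < m, j < m) F (f i) (f j)).
Proof.
move=> f_inj Pf; rewrite /kdet (@det_mxsub_inj _ _ (enum_rank \o f)).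
- congr (\det _); apply/matrixP => i j; rewrite !mxE /= !enum_rankK /kmask Pf.
  by rewrite codom_f.
- exact: inj_comp enum_rank_inj f_inj.
- move=> i iNf j; rewrite mxE /kmask Pf (inj_eq enum_val_inj).
  case: ifP => // /codomP[k ik]; case/negP: iNf; apply/codomP; exists k.
  by rewrite /= -ik enum_valK.
Qed.

(** A vector killed by the masked kernel vanishes off [P]; as [F] has no entry from outside [P] into
    [P], all of [F] kills it. *)
Lemma kdet_mask_neq0 P F : (forall x y, ~~ P x -> P y -> F x y = 0) ->
  (forall v : T -> C, (forall x, \sum_y F x y * v y = 0) -> v =1 (fun=> 0)) ->
  kdet (kmask P F) != 0.
Proof.
(* [det0P] yields a left null vector; transposing makes it a right one. *)
move=> F0 Finj; rewrite /kdet -det_tr; apply/det0P => -[v vN0 /rowP v0].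
have eqv x : \sum_y kmask P F x y * v 0 (enum_rank y) = 0.
  have := v0 (enum_rank x); rewrite !mxE => v0x; rewrite -[RHS]v0x.
  rewrite (big_enum_val (A := T)) /=; apply: eq_bigr => s _.
  by rewrite !mxE enum_rankK enum_valK mulrC.
case/negP: vN0; apply/eqP/rowP => r; rewrite mxE.
have {1}-> : r = enum_rank (enum_val r) by rewrite enum_valK.
apply: (Finj (fun y => v 0 (enum_rank y))) => x; have := eqv x.
rewrite /kmask; case: (boolP (P x)) => // Px _; apply: big1 => y _.
have [Py|Py] := boolP (P y); first by rewrite F0 ?mul0r.
by have := eqv y; rewrite /kmask (negPf Py) sum_delta => ->; rewrite mulr0.
Qed.

End Kernels.

(** * Cells that agree off a set of coordinates *)

Section Cells.
Variables (N p : nat) (T : finType).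
Implicit Types (a b : {set 'I_N}).

Definition agree a (k y : {ffun 'I_N -> T}) := [forall i, (i \notin a) ==> (y i == k i)].

Lemma agreeP a (k y : {ffun 'I_N -> T}) :
  reflect (forall i, i \notin a -> y i = k i) (agree a k y).
Proof.
apply: (iffP forallP) => h i; first by move=> ia; apply/eqP/(implyP (h i)).
by apply/implyP => /h ->.
Qed.

Lemma agree0 (k y : {ffun 'I_N -> T}) : agree set0 k y = (y == k).
Proof.
apply/agreeP/eqP => [h|-> //]; apply/ffunP => i; apply: h.
by rewrite inE.
Qed.

Lemma agree_mergel a (k x : {ffun 'I_N -> T}) : agree a k (Defs.merge a k x).
Proof. by apply/agreeP => i ia; rewrite ffunE (negPf ia). Qed.

Lemma agreexx a (k : {ffun 'I_N -> T}) : agree a k k.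
Proof. exact/agreeP. Qed.

Lemma agree_sym a (k y : {ffun 'I_N -> T}) : agree a k y = agree a y k.
Proof. by apply/agreeP/agreeP => h i /h. Qed.

Lemma agree_trans a (y k z : {ffun 'I_N -> T}) :
  agree a k y -> agree a y z -> agree a k z.
Proof. by move=> /agreeP h /agreeP h'; apply/agreeP => i ia; rewrite h' ?h. Qed.

Lemma agree_sub a b (k y : {ffun 'I_N -> T}) : a \subset b -> agree a k y -> agree b k y.
Proof.
by move=> /subsetP ab /agreeP h; apply/agreeP => i ib; apply/h; apply: contra ib => /ab.
Qed.

(** The fibre is a product set: [x] is forced to equal [y] on [a] and is free elsewhere. *)
Lemma card_merge_fiber a (k y : {ffun 'I_N -> T}) : agree a k y ->
  #|[pred x | Defs.merge a k x == y]| = (#|T| ^ (N - #|a|))%N.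
Proof.
move=> /agreeP ay.
pose Fx i : pred T := if i \in a then pred1 (y i) else predT.
rewrite (eq_card (B := family Fx)); last first.
  move=> x; rewrite inE; apply/eqP/familyP => [xy i|h].
    by rewrite /Fx -xy; case: ifPn => // ia; rewrite inE ffunE ia.
  apply/ffunP => i; have := h i; rewrite /Fx ffunE.
  by case: ifPn => [_ /eqP //|ia _]; rewrite ay.
rewrite card_family foldrE big_map big_enum /=.
rewrite (bigID (mem a)) /= big1 ?mul1n => [|i ia]; last by rewrite /Fx ia card1.
rewrite (eq_bigr (fun=> #|T|)) => [|i /negPf ia]; last by rewrite /Fx ia.
rewrite prod_nat_const; congr (_ ^ _)%N.
by rewrite -[X in (X - _)%N](card_ord N) -(cardC (mem a)) addKn.
Qed.

Lemma sum_merge (V : nmodType) a (k : {ffun 'I_N -> T}) (f : {ffun 'I_N -> T} -> V) :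
  \sum_x f (Defs.merge a k x) = (\sum_(y | agree a k y) f y) *+ #|T| ^ (N - #|a|).
Proof.
rewrite (partition_big (Defs.merge a k) (agree a k)) /=; last first.
  by move=> x _; exact: agree_mergel.
rewrite -sumrMnl; apply: eq_bigr => y ay.
rewrite -(card_merge_fiber ay) -sumr_const; apply: eq_big => x.
  by rewrite inE.
by move/eqP->.
Qed.

End Cells.

(** Passes from the mean over the whole cube, as in [tauL], to the mean over the variables in [a],
    as in [fredholm_det]. *)
Lemma mean_merge (K : numFieldType) N p a (k : cell N p) (f : cell N p -> K) :
  (0 < p)%N ->
  (p ^ N)%:R^-1 * \sum_x f (Defs.merge a k x)
  = (p ^ #|a|)%:R^-1 * \sum_(y | agree a k y) f y.
Proof.
move=> p0; rewrite sum_merge card_ord -[X in _ * X = _]mulr_natl mulrA; congr (_ * _).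
have aN : (#|a| <= N)%N by rewrite -[X in (_ <= X)%N](card_ord N) max_card.
have nz m : (p ^ m)%:R != 0 :> K by rewrite pnatr_eq0 -lt0n expn_gt0 p0.
by rewrite -{1}(subnK aN) expnD natrM invfM mulrAC mulVf ?mul1r.
Qed.

(** * The action on functions of mean zero off [b] *)

Section Symbol.
Variables (R : realType) (N M p : nat).
Local Notation C := R[i].
Local Notation idx := (cell N p * 'I_M)%type.
Implicit Types (A B P : Lfam R N M p) (a b : {set 'I_N}) (v : idx -> C).

(** This is the matrix $T_b(A)$. The factor [agree] expresses that the term of [a] integrates over
    the variables in [a] and fixes the others. *)
Definition Lker b A (x y : idx) : C :=
  \sum_(a : {set 'I_N} | a \subset b)
    (agree a x.1 y.1)%:R * ((p ^ #|a|)%:R^-1 * A a x.1 y.1 x.2 y.2).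

Definition Lapp b A v (x : idx) : C := \sum_y Lker b A x y * v y.

Definition sgn2 (j : 'I_2) : C := if j == ord0 then 1 else -1.

Definition wave b (g : fine N p 2) : C := \prod_(i | i \notin b) sgn2 (g i).2.

(* Constant in the coordinates of [b] and of mean zero in the other ones,
   inside each h-cell. *)
Definition emb b v : vfun R N M p 2 := fun g => \col_i (wave b g * v (coarse g, i)).

Lemma Lker_eq0 b A x y : ~~ agree b x.1 y.1 -> Lker b A x y = 0.
Proof.
move=> nxy; apply: big1 => a ab.
by case: (boolP (agree a _ _)) nxy => [/(agree_sub ab) ->//|]; rewrite mul0r.
Qed.

(** Integrating over a coordinate of [a] outside [b] adds the two opposite signs and gives 0; if
    there is none, every sign of [wave b] sits at a fixed coordinate and comes out of the mean. *)
Lemma mean_wave a b (g : fine N p 2) (f : cell N p -> C) : (0 < p)%N ->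
  ((p * 2) ^ N)%:R^-1 *
    \sum_(y : fine N p 2) wave b (Defs.merge a g y) * f (coarse (Defs.merge a g y))
  = wave b g * ((a \subset b)%:R *
      ((p ^ #|a|)%:R^-1 * \sum_(y | agree a (coarse g) y) f y)).
Proof.
move=> p0; pose h (xt : cell N p * {ffun 'I_N -> 'I_2}) : fine N p 2 :=
  [ffun i => (xt.1 i, xt.2 i)].
pose h' (y : fine N p 2) : cell N p * {ffun 'I_N -> 'I_2} :=
  (coarse y, [ffun i => (y i).2]).
have hK : cancel h h'.
  by move=> [x t]; congr (_, _); apply/ffunP => i; rewrite !ffunE.
have h'K : cancel h' h.
  by move=> y; apply/ffunP => i; rewrite !ffunE /=; case: (y i).
rewrite (reindex h) /=; last by exists h' => y _; [exact: hK | exact: h'K].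
rewrite -(pair_bigA _ (fun x t => wave b (Defs.merge a g (h (x, t))) *
  f (coarse (Defs.merge a g (h (x, t)))))) /=.
(* The sum over the halves [t] factors over the coordinates; [w i] is the factor of coordinate [i],
   and it sums to 0 for [i] in [a] but not in [b]. *)
pose w i j : C := if i \in b then 1 else if i \in a then sgn2 j else sgn2 (g i).2.
have waveE x t : wave b (Defs.merge a g (h (x, t))) = \prod_i w i (t i).
  rewrite /wave big_mkcond; apply: eq_bigr => i _; rewrite /w.
  by case: (i \in b) => //=; rewrite ffunE; case: (i \in a) => //=; rewrite ffunE.
have sum_w : \sum_(t : {ffun 'I_N -> 'I_2}) \prod_i w i (t i)
    = wave b g * ((a \subset b)%:R * (2 ^ N)%:R).
  rewrite -(bigA_distr_bigA w) /=.
  have [ab|/subsetPn[i ia ib]] := boolP (a \subset b); last first.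
    rewrite mul0r mulr0 (bigD1 i) //= /w (negPf ib) ia !big_ord_recl big_ord0.
    by rewrite /sgn2 /= addr0 subrr mul0r.
  rewrite mul1r /wave [X in X * _]big_mkcond -[N in (2 ^ N)%N]card_ord.
  rewrite -prod_nat_const natr_prod -big_split; apply: eq_bigr => i _ /=.
  rewrite /w; case: (boolP (i \in b)) => ib /=.
    by rewrite sumr_const card_ord mul1r.
  rewrite (negPf (contra (subsetP ab i) ib)) sumr_const card_ord.
  by rewrite mulr_natr.
have -> : \sum_x \sum_t wave b (Defs.merge a g (h (x, t))) *
      f (coarse (Defs.merge a g (h (x, t))))
    = wave b g * ((a \subset b)%:R * (2 ^ N)%:R) *
      \sum_x f (Defs.merge a (coarse g) x).
  rewrite -sum_w mulr_sumr; apply: eq_bigr => x _.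
  rewrite mulr_suml; apply: eq_bigr => t _; rewrite waveE; congr (_ * f _).
  by apply/ffunP => i; rewrite !ffunE; case: ifP; rewrite ?ffunE.
rewrite -mean_merge // expnMn natrM invfM.
have n2 : (2 ^ N)%:R != 0 :> C by rewrite pnatr_eq0 expn_eq0.
move: (2 ^ N)%:R (p ^ N)%:R^-1 n2 => x q x0; field; exact: x0.
Qed.

Lemma opL_emb b A v : (0 < p)%N -> opL A (emb b v) = emb b (Lapp b A v).
Proof.
move=> p0; apply/funext => g; apply/colP => i; rewrite /opL summxE mxE.
rewrite /Lapp /Lker.
under [in RHS]eq_bigr do rewrite mulr_suml.
rewrite exchange_big mulr_sumr [RHS]big_mkcond /=; apply: eq_bigr => a _.
pose f c := \sum_j A a (coarse g) c i j * v (c, j).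
rewrite mxE summxE.
rewrite (eq_bigr (fun y => wave b (Defs.merge a g y) *
    f (coarse (Defs.merge a g y)))); last first.
  move=> y _; rewrite mxE mulr_sumr; apply: eq_bigr => j _.
  by rewrite mxE mulrCA.
rewrite mean_wave //; case: ifP => _; last by rewrite mul0r mulr0.
rewrite mul1r; congr (_ * _).
transitivity (\sum_c \sum_j (agree a (coarse g) c)%:R *
    ((p ^ #|a|)%:R^-1 * A a (coarse g) c i j) * v (c, j)); last first.
  by rewrite pair_bigA; apply: eq_bigr => -[].
rewrite mulr_sumr big_mkcond; apply: eq_bigr => c _; case: (agree _ _ _).
  by rewrite mulr_sumr; apply: eq_bigr => j _; rewrite mul1r mulrA.
by rewrite big1 // => j _; rewrite !mul0r.
Qed.

(** The half-cells where all signs are 1, so that evaluation there recovers [v] from [emb b v]. *)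
Definition crest (c : cell N p) : fine N p 2 := [ffun i => (c i, ord0)].

Lemma emb_crest b v c i : emb b v (crest c) i 0 = v (c, i).
Proof.
rewrite mxE (_ : coarse (crest c) = c); last by apply/ffunP => j; rewrite !ffunE.
by rewrite /wave big1 ?mul1r // => j _; rewrite ffunE.
Qed.

Lemma emb_inj b v w : emb b v = emb b w -> v =1 w.
Proof. by move=> vw [c i]; rewrite -!(emb_crest b) vw. Qed.

(** The range of [emb b] is invariant and [emb b] is injective, so an identity of operators becomes
    one of matrices once tested on the basis vectors [d]. *)
Lemma Lker_comp b A B P : (0 < p)%N ->
  (forall (u : vfun R N M p 2) g, opL P u g = opL A (opL B u) g) ->
  Lker b P =2 kmul (Lker b A) (Lker b B).
Proof.
move=> p0 PAB x y; pose d (z : idx) : C := (y == z)%:R.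
have appd A' z : Lapp b A' d z = Lker b A' z y.
  by rewrite /Lapp; under eq_bigr do rewrite mulrC; rewrite sum_delta.
have /emb_inj/(_ x) : emb b (Lapp b P d) = emb b (Lapp b A (Lapp b B d)).
  by rewrite -!opL_emb //; apply/funext => g; exact: PAB.
rewrite appd => ->; apply: eq_bigr => z _.
by rewrite appd.
Qed.

End Symbol.

(** * Block determinants and traces, split over subsets *)

Section Blocks.
Variables (R : realType) (N M p : nat).
Hypothesis p0 : (0 < p)%N.
Local Notation C := R[i].
Local Notation idx := (cell N p * 'I_M)%type.
Implicit Types (A B P G : Lfam R N M p) (a b : {set 'I_N}) (k y c : cell N p).

Lemma agree_key a b k c : a \subset b ->
  agree (b :\: a) k (Defs.merge a c k) = agree b k c.
Proof.
move=> /subsetP ab; apply/agreeP/agreeP => h i ib; last first.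
  rewrite ffunE; case: ifPn => // ia; apply: h.
  by move: ib; rewrite inE ia.
have ia : i \notin a by apply: contra ib => /ab.
by have := h i; rewrite inE (negPf ib) andbF ffunE (negPf ia); exact.
Qed.

Lemma key_eq a b k y c : agree (b :\: a) k y ->
  (Defs.merge a c k == y) = agree a y c.
Proof.
move=> /agreeP ky; apply/eqP/agreeP => [<- i ia|h]; first by rewrite ffunE (negPf ia).
apply/ffunP => i; rewrite ffunE; case: ifPn => [ia|/h //].
by rewrite ky // inE ia.
Qed.

(* The determinant and the trace of the diagonal block of [Lker b A] formed by
   the cells that agree with [k] off [b]. *)
Definition Ldet b k A : C := kdet (kmask (fun x : idx => agree b k x.1) (Lker b A)).

Definition Ltr b k A : C := \sum_(x : idx | agree b k x.1) Lker b A x x.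

Lemma agree_left b k (x y : idx) : agree b k x.1 -> ~~ agree b k y.1 ->
  ~~ agree b x.1 y.1.
Proof. by move=> kx; apply: contra => /(agree_trans kx). Qed.

Lemma agree_right b k (x y : idx) : ~~ agree b k x.1 -> agree b k y.1 ->
  ~~ agree b x.1 y.1.
Proof.
by move=> kx ky; apply: contra kx; rewrite agree_sym => /(agree_trans ky).
Qed.

Lemma Ldet_comp b k A B P :
  (forall (u : vfun R N M p 2) g, opL P u g = opL A (opL B u) g) ->
  Ldet b k P = Ldet b k A * Ldet b k B.
Proof.
move=> PAB; rewrite /Ldet -kdet_mask_mul => [|x y kx ky]; last first.
  by rewrite Lker_eq0 // (agree_left kx).
by apply: eq_kdet => x y; rewrite /kmask (Lker_comp b p0 PAB).
Qed.

Lemma Ltr_comp b k A B P :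
  (forall (u : vfun R N M p 2) g, opL P u g = opL A (opL B u) g) ->
  Ltr b k P = \sum_(x : idx | agree b k x.1) \sum_(y : idx | agree b k y.1)
    Lker b A x y * Lker b B y x.
Proof.
move=> PAB; apply: eq_bigr => x kx; rewrite (Lker_comp b p0 PAB) /kmul.
rewrite [RHS]big_mkcond; apply: eq_bigr => y _; case: ifPn => // ky.
by rewrite Lker_eq0 ?mul0r // (agree_left kx).
Qed.

(** A null vector of [Lker b A] would give, through [emb b], a function killed by the injective
    operator [A] on the grid with [q = 2]. *)
Lemma Ldet_neq0 b k A : invL A -> Ldet b k A != 0.
Proof.
move=> [_ /(_ 2 isT) /bij_inj A_inj]; apply: kdet_mask_neq0 => [x y kx ky|v v0].
  by rewrite Lker_eq0 // (agree_right kx).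
apply: (@emb_inj _ _ _ _ b); apply: A_inj; rewrite !opL_emb //.
congr emb; apply/funext => x; rewrite /Lapp v0.
by rewrite big1 // => y _; rewrite mulr0.
Qed.

Lemma Lker_factor b G a (x y : idx) : Lker b (factorL G a) x y =
  if a == set0 then (x.1 == y.1)%:R * G set0 x.1 y.1 x.2 y.2
  else (x == y)%:R + (a \subset b)%:R *
    ((agree a x.1 y.1)%:R * ((p ^ #|a|)%:R^-1 * G a x.1 y.1 x.2 y.2)).
Proof.
rewrite /Lker (bigD1 set0) ?sub0set //= agree0 cards0 expn0 invr1 mul1r [y.1 == _]eq_sym.
rewrite /factorL eqxx; have [a0|a0] := eqVneq a set0.
  by rewrite big1 ?addr0 // => c /andP[_ /negPf->]; rewrite mxE !mulr0.
rewrite mxE -natrM mulnb; congr (_ + _).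
have [ab|ab] := boolP (a \subset b).
  rewrite (bigD1 a) ?ab //= (negPf a0) eqxx mul1r big1 ?addr0 // => c.
  by move=> /andP[/andP[_ /negPf->] /negPf->]; rewrite mxE !mulr0.
rewrite big1 ?mul0r // => c /andP[cb /negPf->].
by case: eqP cb => [->|_ _]; rewrite ?(negPf ab) // mxE !mulr0.
Qed.

Lemma Ldet_factor_id b k G a : ~~ (a \subset b) -> Ldet b k (factorL G a) = 1.
Proof.
move=> ab; have a0 : a != set0 by apply: contraNneq ab => ->; rewrite sub0set.
rewrite -(kdet_id C idx); apply: eq_kdet => x y; rewrite /kmask.
by rewrite Lker_factor (negPf a0) (negPf ab) mul0r addr0 if_same.
Qed.

(** For [b = a] the block is, entry by entry, the matrix that defines [piL]; for [set0] it reduces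
    to the single cell [k]. *)
Lemma Ldet_factor_self k G a : Ldet a k (factorL G a) = piL G a k.
Proof.
rewrite /Ldet /piL; have [->|a0] := eqVneq a set0.
  rewrite (@kdet_mask_sub _ _ _ (fun j : 'I_M => (k, j))).
  - by congr (\det _); apply/matrixP => i j; rewrite mxE Lker_factor !eqxx mul1r.
  - by move=> i j [].
  - move=> [c i]; rewrite agree0 /=; apply/eqP/codomP => [->|[j [-> _]] //].
    by exists i.
rewrite /fredholm_det; set I := (slice a k * 'I_M)%type.
pose f (r : 'I_#|{: I}|) : idx := (val (enum_val r).1, (enum_val r).2).
have f_inj : injective f.
  move=> r s [] /val_inj e1 e2; apply: enum_val_inj.
  by move: e1 e2; case: (enum_val r) (enum_val s) => ? ? [? ?] /= -> ->.
rewrite (@kdet_mask_sub _ _ _ f) //.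
  congr (\det _); apply/matrixP => r s; rewrite !mxE Lker_factor (negPf a0).
  rewrite subxx mul1r (inj_eq f_inj) /f.
  case: (enum_val r) (enum_val s) => y i [y' j] /=.
  suff -> : agree a (val y) (val y') by rewrite mul1r.
  apply: (@agree_trans _ _ a k); last exact: (valP y').
  by rewrite agree_sym; exact: (valP y).
move=> [c i] /=; apply/idP/codomP => [kc|[r [-> _]]]; last exact: (valP (enum_val r).1).
exists (enum_rank ((exist _ c kc : slice a k), i)).
by rewrite /f enum_rankK.
Qed.

(** This factor couples only cells that agree off [a], so the block of [b] breaks into one block of
    [a] per label [y]. *)
Lemma Ldet_factor b k G a : a \subset b ->
  Ldet b k (factorL G a) = \prod_(y | agree (b :\: a) k y) piL G a y.
Proof.
move=> ab; pose s := enum (agree (b :\: a) k).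
have memS y : (y \in s) = agree (b :\: a) k y by rewrite mem_enum.
rewrite /Ldet -big_enum /= -/s.
under eq_bigr do rewrite -Ldet_factor_self.
transitivity (kdet (kmask (fun x : idx => Defs.merge a x.1 k \in s)
    (Lker a (factorL G a)))).
  apply: eq_kdet => x y; rewrite /kmask memS agree_key //.
  by rewrite !Lker_factor ab subxx.
rewrite kdet_mask_key ?enum_uniq // => [|x y].
  apply: eq_big_seq => y; rewrite memS => ky.
  by apply: eq_kdet => x z; rewrite /kmask (key_eq _ ky).
move=> xy; apply: Lker_eq0; apply: contraNN xy => /agreeP xy.
by apply/eqP/ffunP => i; rewrite !ffunE; case: ifPn => // /xy ->.
Qed.

Lemma piL_neq0 ord A G a k : is_factorization ord A G -> piL G a k != 0.
Proof.
move=> [_ [Gu [Ginv _]]]; have [->|/Ginv a0] := eqVneq a set0.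
  by rewrite /piL eqxx -unitfE -unitmxE.
by rewrite -Ldet_factor_self; exact: Ldet_neq0.
Qed.

Lemma Ldet_factorization ord A G b k : valid_order ord -> is_factorization ord A G ->
  Ldet b k A = \prod_(a : {set _} | a \subset b) \prod_(y | agree (b :\: a) k y) piL G a y.
Proof.
move=> [uord [allord _]] [_ [_ [_ /(_ 2 isT) opA]]].
(* The partial products are given as operators, not as families, so their action on [emb b] is
   carried by a kernel [F] built along [ord]. *)
have [F [opF F0 detF]] : exists F : idx -> idx -> C, [/\
    forall v, foldr (fun a f => @opL R N M p 2 (factorL G a) \o f) id ord (emb b v)
      = emb b (fun x : idx => \sum_(y : idx) F x y * v y),
    forall x y : idx, ~~ agree b x.1 y.1 -> F x y = 0 &
    kdet (kmask (fun x : idx => agree b k x.1) F) = \prod_(a <- ord) Ldet b k (factorL G a)].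
  elim: ord {uord allord opA} => [|a r [F [opF F0 detF]]].
    exists (fun x y : idx => (x == y)%:R); split.
    - by move=> v /=; congr emb; apply/funext => x; rewrite sum_delta.
    - by move=> x y; apply: contraNeq; case: (eqVneq x y) => [->|_]; rewrite ?agreexx ?eqxx.
    - rewrite big_nil -[RHS](kdet_id C idx); apply: eq_kdet => x y.
      by rewrite /kmask if_same.
  exists (kmul (Lker b (factorL G a)) F); split.
  - move=> v /=; rewrite opF opL_emb //; congr emb; apply/funext => x.
    rewrite /Lapp /kmul; under [RHS]eq_bigr do rewrite mulr_suml.
    rewrite exchange_big; apply: eq_bigr => y _ /=.
    by rewrite mulr_sumr; apply: eq_bigr => z _; rewrite mulrA.
  - move=> x y xy; apply: big1 => z _; have [xz|xz] := boolP (agree b x.1 z.1).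
      by rewrite (F0 z) ?mulr0 // (agree_left xz).
    by rewrite Lker_eq0 ?mul0r.
  - rewrite kdet_mask_mul => [|x y kx ky]; last first.
      by rewrite Lker_eq0 // (agree_left kx).
    by rewrite big_cons detF.
have FE : Lker b A =2 F.
  move=> x y; pose d (z : idx) : C := (y == z)%:R.
  have /emb_inj/(_ x) : emb b (Lapp b A d) = emb b (fun x : idx => \sum_(y : idx) F x y * d y).
    by rewrite -opF -opL_emb //; apply/funext => g; exact: opA.
  rewrite /Lapp; under eq_bigr do rewrite mulrC.
  by under [RHS]eq_bigr do rewrite mulrC; rewrite !sum_delta.
rewrite /Ldet (eq_kdet (G := kmask (fun x : idx => agree b k x.1) F)); last first.
  by move=> x y; rewrite /kmask FE.
(* [ord] lists each subset once; the factors with [a] not inside [b] contribute 1. *)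
rewrite detF (perm_big (index_enum _)) /=; last first.
  apply: uniq_perm => // [|a]; first exact: index_enum_uniq.
  by rewrite allord mem_index_enum.
rewrite (bigID (fun a : {set _} => a \subset b)) /= [X in _ * X]big1 ?mulr1.
  by apply: eq_bigr => a ab; exact: Ldet_factor.
by move=> a; exact: Ldet_factor_id.
Qed.

Lemma Ldet_split ord A G b k : valid_order ord -> is_factorization ord A G ->
  Ldet b k A = piL G b k *
    \prod_(a : {set _} | a \proper b) \prod_(y | agree (b :\: a) k y) piL G a y.
Proof.
move=> vo fA; rewrite (Ldet_factorization _ _ vo fA) (bigD1 b) //=; congr (_ * _).
  by rewrite setDv (eq_bigl (pred1 k)) ?big_pred1_eq // => y; rewrite agree0.
by apply: eq_bigl => a; rewrite properEneq andbC.
Qed.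

Lemma Ltr_split A b k : wfL A -> Ltr b k A = tauL A b k +
    \sum_(a : {set _} | a \proper b) \sum_(y | agree (b :\: a) k y) tauL A a y.
Proof.
move=> wA; pose t a c : C := (p ^ #|a|)%:R^-1 * \tr (A a c c).
have tauE a y : tauL A a y = \sum_(c | agree a y c) t a c.
  rewrite -mulr_sumr -mean_merge //; congr (_ * _); apply: eq_bigr => x _.
  by congr (\tr _); apply: wA => i ia; rewrite ffunE ia.
transitivity (\sum_(a : {set _} | a \subset b) \sum_(y | agree (b :\: a) k y) tauL A a y).
  transitivity (\sum_(c | agree b k c) \sum_(i < M) Lker b A (c, i) (c, i)).
    by rewrite pair_big; apply: eq_big => [] [c i]; rewrite ?andbT.
  rewrite /Lker; under eq_bigr do rewrite exchange_big /=.
  rewrite exchange_big; apply: eq_bigr => a ab /=.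
  (* The diagonal is grouped by classes modulo [a]; the class labelled [y] sums to [tauL A a y]. *)
  rewrite (partition_big (fun c => Defs.merge a c k) (agree (b :\: a) k)) /=; last first.
    by move=> c; rewrite agree_key.
  apply: eq_bigr => y ky; rewrite tauE; apply: eq_big => c.
    rewrite (key_eq _ ky) -(agree_key _ _ ab) andb_idl // -(key_eq _ ky).
    by move=> /eqP ->.
  by move=> _; rewrite -mulr_sumr agreexx mul1r -mulr_sumr.
rewrite (bigD1 b) //=; congr (_ + _).
  by rewrite setDv (eq_bigl (pred1 k)) ?big_pred1_eq // => y; rewrite agree0.
by apply: eq_bigl => a; rewrite properEneq andbC.
Qed.

End Blocks.

(** * Norm estimates for the trace *)

Section Bounds.
Variables (R : realType) (N M p : nat).
Hypothesis p0 : (0 < p)%N.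
Local Notation C := R[i].
Implicit Types (A B P G : Lfam R N M p) (a b : {set 'I_N}) (k x : cell N p).

Lemma normc_sum (I : finType) (f : I -> C) :
  Normc.normc (\sum_i f i) <= \sum_i Normc.normc (f i).
Proof.
rewrite -lecR raddf_sum /= -[leLHS]/(`|\sum_i f i|).
by rewrite [leRHS](eq_bigr (fun i => `|f i|)) ?ler_norm_sum.
Qed.

Lemma normc_natr n : Normc.normc (n%:R : C) = n%:R.
Proof. by apply: (@complexI R); rewrite rmorph_nat; exact: normr_nat. Qed.

Lemma normc_ge0 (z : C) : 0 <= Normc.normc z.
Proof. by rewrite -lecR; exact: (normr_ge0 z). Qed.

Lemma normc_le_normL A a k x i j : Normc.normc (A a k x i j) <= normL A.
Proof.
rewrite /normL (bigD1 a) //= -[leLHS]addr0; apply: lerD; last first.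
  by apply: sumr_ge0 => b _; exact: bigmax_ge_id.
apply: le_trans (le_bigmax _ _ k) => /=; apply: le_trans (le_bigmax _ _ x) => /=.
apply: le_trans (le_bigmax _ _ i) => /=; rewrite (bigD1 j) //= lerDl.
by apply: sumr_ge0 => l _; exact: normc_ge0.
Qed.

Lemma normc_tauL A a k : Normc.normc (tauL A a k) <= M%:R * normL A.
Proof.
rewrite /tauL Normc.normcM Normc.normcV normc_natr.
have pN : 0 < (p ^ N)%:R :> R by rewrite ltr0n expn_gt0 p0.
rewrite -ler_pdivlMl ?invr_gt0 // invrK; apply: le_trans (normc_sum _) _.
apply: (@le_trans _ _ (\sum_(x : cell N p) M%:R * normL A)); last first.
  by rewrite sumr_const card_ffun !card_ord -[leLHS]mulr_natl.
apply: ler_sum => x _; apply: le_trans (normc_sum _) _.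
apply: (@le_trans _ _ (\sum_(i < M) normL A)); last first.
  by rewrite sumr_const card_ord -[leLHS]mulr_natl.
by apply: ler_sum => i _; exact: normc_le_normL.
Qed.

Lemma tauL_linear (lam mu : C) A B a k :
  tauL (addL (scaleL lam A) (scaleL mu B)) a k = lam * tauL A a k + mu * tauL B a k.
Proof.
rewrite /tauL mulrCA [mu * _]mulrCA -mulrDr; congr (_ * _).
rewrite !mulr_sumr -big_split; apply: eq_bigr => x _ /=.
by rewrite /addL /scaleL mxtraceD !mxtraceZ.
Qed.

Lemma normC_lt (f : Cfam R N p) e : 0 < e ->
  (forall a k, Normc.normc (f a k) < e) -> normC f < e.
Proof. by move=> e0 h; do 2![apply: bigmax_lt => // ? _]. Qed.

Lemma continuous_tauL A e : 0 < e -> exists d : R, 0 < d /\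
  forall B, normL (addL B (scaleL (-1) A)) < d ->
  normC (fun a k => tauL B a k - tauL A a k) < e.
Proof.
(* [M + 1] is a Lipschitz constant of [tauL] that stays positive for [M = 0]. *)
move=> e0; have M0 : 0 < M%:R + 1 :> R by rewrite ltr_wpDl.
exists (e / (M%:R + 1)); split=> [|B dB]; first exact: divr_gt0.
apply: normC_lt => // a k.
have -> : tauL B a k - tauL A a k = tauL (addL B (scaleL (-1) A)) a k.
  have := tauL_linear 1 (-1) B A a k; rewrite mul1r mulN1r => <-; congr tauL.
  by rewrite /addL /scaleL; do 3![apply/funext => ?]; rewrite scale1r.
apply: le_lt_trans (normc_tauL _ _ _) _.
apply: (@le_lt_trans _ _ ((M%:R + 1) * normL (addL B (scaleL (-1) A)))).
  by rewrite ler_wpM2r ?lerDl // sumr_ge0 // => b _; exact: bigmax_ge_id.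
by rewrite mulrC -ltr_pdivlMr.
Qed.

(** The identity operator, at which the operator norm of the trace is attained. *)
Definition idL : Lfam R N M p := fun a k x => if a == set0 then 1%:M else 0.

Lemma wf_idL : wfL idL. Proof. by []. Qed.

Lemma normL_idL : normL idL <= 1.
Proof.
rewrite /normL (bigD1 set0) //= big1 ?addr0 => [|a /negPf a0].
  do 2![apply: bigmax_le => // ? _]; apply: bigmax_le => // i _; rewrite /idL eqxx.
  rewrite (bigD1 i) //= big1 ?addr0 => [|j ji]; rewrite mxE.
    by rewrite eqxx normc_natr.
  by rewrite eq_sym (negPf ji) normc_natr.
apply/eqP; rewrite eq_le bigmax_ge_id andbT.
do 3![apply: bigmax_le => // ? _]; rewrite /idL a0 big1 // => j _.
by rewrite mxE; exact: (normc_natr 0).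
Qed.

Lemma normC_tau_idL : M%:R <= normC (tauL idL).
Proof.
have k : cell N p := [ffun=> Ordinal p0].
apply: le_trans (le_bigmax _ _ set0) => /=; apply: le_trans (le_bigmax _ _ k) => /=.
rewrite /tauL /idL eqxx sumr_const mxtrace1 card_ffun !card_ord -[M%:R *+ _]mulr_natl mulrA.
by rewrite mulVf ?mul1r ?normc_natr // pnatr_eq0 -lt0n expn_gt0 p0.
Qed.

End Bounds.

(** * Inductions on [b] for the trace and the determinant *)

Section TauPi.
Variables (R : realType) (N M p : nat).
Hypothesis p0 : (0 < p)%N.
Variable ord : seq {set 'I_N}.
Hypothesis hord : valid_order ord.
Local Notation C := R[i].
Local Notation idx := (cell N p * 'I_M)%type.
Local Notation cvg_seq := (tends (\oo)%classic).
Implicit Types (A B P G : Lfam R N M p) (a b : {set 'I_N}) (k y : cell N p).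

Lemma proper_set_ind (Q : {set 'I_N} -> Prop) :
  (forall b, (forall a, a \proper b -> Q a) -> Q b) -> forall b, Q b.
Proof.
move=> h b; have [n] := ubnP #|b|; elim: n b => // n IH b bn.
apply: h => a /proper_card ab; apply: IH.
by apply: leq_trans ab _; rewrite -ltnS.
Qed.

Lemma tauL_comm A B P Q : wfL P -> wfL Q ->
  (forall (u : vfun R N M p 2) g, opL P u g = opL A (opL B u) g) ->
  (forall (u : vfun R N M p 2) g, opL Q u g = opL B (opL A u) g) ->
  forall b k, tauL P b k = tauL Q b k.
Proof.
move=> wP wQ PAB QBA; elim/proper_set_ind => b IH k.
have : Ltr b k P = Ltr b k Q.
  rewrite (Ltr_comp p0 _ _ PAB) (Ltr_comp p0 _ _ QBA) exchange_big /=.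
  by apply: eq_bigr => x _; apply: eq_bigr => y _; rewrite mulrC.
rewrite !(Ltr_split p0) // [X in _ + X](eq_bigr (fun a =>
  \sum_(y | agree (b :\: a) k y) tauL Q a y)); first exact: addIr.
by move=> a /IH ab; apply: eq_bigr => y _; exact: ab.
Qed.

Lemma prod_piL_neq0 A G b k : is_factorization ord A G ->
  \prod_(a : {set 'I_N} | a \proper b) \prod_(y | agree (b :\: a) k y) piL G a y != 0.
Proof.
move=> fA; apply/prodf_neq0 => a _; apply/prodf_neq0 => y _.
exact: piL_neq0 fA.
Qed.

Lemma piL_mul A B P GA GB GP :
  (forall (u : vfun R N M p 2) g, opL P u g = opL A (opL B u) g) ->
  is_factorization ord A GA -> is_factorization ord B GB ->
  is_factorization ord P GP ->
  forall b k, piL GP b k = piL GA b k * piL GB b k.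
Proof.
move=> PAB fA fB fP; elim/proper_set_ind => b IH k.
have := Ldet_comp p0 b k PAB.
rewrite (Ldet_split p0 _ _ hord fA) (Ldet_split p0 _ _ hord fB).
rewrite (Ldet_split p0 _ _ hord fP) mulrACA -big_split /=.
under [in X in _ = _ * X -> _]eq_bigr => a ab.
  rewrite -big_split /=; under eq_bigr do rewrite -IH //.
  over.
(* The product over the proper subsets is nonzero because the factors are invertible, so it
   cancels. *)
exact/mulIf/(prod_piL_neq0 b k fP).
Qed.

(** Neighbourhoods of [A] among invertible elements, each paired with a factorization because [piL]
    is computed from the latter. *)
Definition near_Lfam A (S : Lfam R N M p * Lfam R N M p -> Prop) : Prop :=
  exists d : R, 0 < d /\ forall B H, invL B -> is_factorization ord B H ->
    normL (addL B (scaleL (-1) A)) < d -> S (B, H).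

Lemma near_Lfam_filter A : Filter (near_Lfam A).
Proof.
split.
- by exists 1.
- move=> S S' [d [d0 hd]] [d' [d'0 hd']]; exists (Num.min d d'); split.
    by rewrite lt_min d0 d'0.
  by move=> B H iB fB; rewrite lt_min => /andP[? ?]; split; [exact: hd|exact: hd'].
- by move=> S S' SS' [d [d0 hd]]; exists d; split=> // B H iB fB /(hd B H iB fB)/SS'.
Qed.

(** [Ldet] is polynomial in the entries of the family, and [piL] at [b] is its quotient by a nonzero
    product over proper subsets, which converges by induction. *)
Lemma tends_piL A G : is_factorization ord A G ->
  forall b k, tends (near_Lfam A) (fun BH => piL BH.2 b k) (piL G b k).
Proof.
move=> fA; have FF := near_Lfam_filter A.
have tA a k x i j : tends (near_Lfam A) (fun BH => BH.1 a k x i j) (A a k x i j).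
  apply/tends_normc => e e0; exists e; split=> // B H _ _ /=.
  apply: le_lt_trans; apply: le_trans (normc_le_normL _ a k x i j).
  by rewrite /addL /scaleL !mxE mulN1r.
have tD b k : tends (near_Lfam A) (fun BH => Ldet b k BH.1) (Ldet b k A).
  apply: tends_det => r s; rewrite mxE.
  apply: (@eq_tends _ _ _ _ (fun BH => kmask (fun x : idx => agree b k x.1)
    (Lker b BH.1) (enum_val r) (enum_val s))) => [BH|]; first by rewrite mxE.
  rewrite /kmask; case: ifP => _; last exact: tends_cst.
  apply: tends_sum => a _; apply: tendsM; first exact: tends_cst.
  by apply: tendsM; [exact: tends_cst | exact: tA].
elim/proper_set_ind => b IH k.
pose r H := \prod_(a : {set 'I_N} | a \proper b)
  \prod_(y | agree (b :\: a) k y) piL (H : Lfam R N M p) a y.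
have quot B H : is_factorization ord B H -> Ldet b k B / r H = piL H b k.
  by move=> fB; rewrite (Ldet_split p0 _ _ hord fB) mulfK // (prod_piL_neq0 b k fB).
have h : tends (near_Lfam A) (fun BH => Ldet b k BH.1 / r BH.2) (Ldet b k A / r G).
  apply: tendsM => //; apply: tendsV; first exact: prod_piL_neq0 fA.
  by apply: tends_prod => a ab; apply: tends_prod => y _; exact: IH.
rewrite quot // in h; move=> e /h[d [d0 hd]]; exists d; split=> // B H iB fB dB.
by have := hd B H iB fB dB; rewrite /= quot.
Qed.

Lemma continuous_piL A G e : is_factorization ord A G -> 0 < e ->
  exists d : R, 0 < d /\ forall B H, invL B -> is_factorization ord B H ->
    normL (addL B (scaleL (-1) A)) < d ->
    normC (fun a k => piL H a k - piL G a k) < e.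
Proof.
move=> fA e0; have FF := near_Lfam_filter A.
pose close (ak : {set 'I_N} * cell N p) (BH : Lfam R N M p * Lfam R N M p) :=
  Normc.normc (piL BH.2 ak.1 ak.2 - piL G ak.1 ak.2) < e.
have : near_Lfam A (fun BH => forall ak, close ak BH).
  (* There are finitely many pairs of a subset and a cell, so one radius serves them all. *)
  apply: (@filter_forall _ _ close _ FF) => -[a k].
  by have /tends_normc := tends_piL fA a k; exact.
move=> [d [d0 hd]]; exists d; split=> // B H iB fB dB; apply: normC_lt => // a k.
exact: (hd B H iB fB dB (a, k)).
Qed.

Lemma cvgC_tends (s : nat -> C) l : cvgC s l <-> cvg_seq s l.
Proof.
split=> [h|/tends_normc h e e0].
  by apply/tends_normc => e /h[n0 hn]; exists n0.
by have [n0 _ hn] := h e e0; exists n0.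
Qed.

Lemma exp_Ldet A E b k : is_expL A E -> cvg_seq (exp_sum (Ltr b k A)) (Ldet b k E).
Proof.
move=> [_ /(_ 2 isT) AE].
pose S (x : idx) := agree b k x.1.
(* Rows off the block are 0 here: exponentiating them yields the identity rows of [kmask], and they
   add nothing to the trace. *)
pose X : 'M[C]_#|{: idx}| := \matrix_(r, s)
  if S (enum_val r) then Lker b A (enum_val r) (enum_val s) else 0.
(* Column [t] of the [m]-th power of [Lker b A]. *)
pose w m (t : idx) : idx -> C := iter m (Lapp b A) (fun z => (t == z)%:R).
have XE r s : X r s =
    if S (enum_val r) then Lker b A (enum_val r) (enum_val s) else 0 by rewrite mxE.
have wS m t z : w m.+1 t z = \sum_z' Lker b A z z' * w m t z' by [].
have iterE m t : iter m (opL A) (emb b (fun z : idx => (t == z)%:R)) = emb b (w m t).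
  by elim: m => //= m ->; rewrite opL_emb.
have expX m r s : (X ^+ m) r s =
    if S (enum_val r) then w m (enum_val s) (enum_val r) else ((m == 0%N) && (r == s))%:R.
  elim: m r s => [|m IH] r s.
    by rewrite expr0 mxE /= (inj_eq enum_val_inj) eq_sym if_same.
  rewrite exprS mxE; case: ifPn => Sr; last first.
    by rewrite big1 // => t _; rewrite XE (negPf Sr) mul0r.
  rewrite wS [RHS]big_enum_val; apply: eq_bigr => t _; rewrite XE Sr IH.
  case: ifPn => // St; rewrite Lker_eq0 ?mul0r //.
  exact: agree_left Sr St.
have -> : Ltr b k A = \tr X.
  rewrite /Ltr big_mkcond [LHS]big_enum_val /=; apply: eq_bigr => r _.
  by rewrite mxE.
apply: det_mx_exp => r s; rewrite mxE /kmask -/(S (enum_val r)).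
have sumX n : mx_exp_sum X n r s = \sum_(0 <= m < n) (m`!)%:R^-1 * (X ^+ m) r s.
  by rewrite /mx_exp_sum summxE; apply: eq_bigr => m _; rewrite mxE.
case: ifPn => Sr.
  have /cvgC_tends := AE (emb b (fun z : idx => (enum_val s == z)%:R))
    (crest (enum_val r).1) (enum_val r).2.
  rewrite opL_emb // emb_crest -surjective_pairing /Lapp.
  under eq_bigr do rewrite mulrC; rewrite sum_delta.
  apply: eq_tends => n; rewrite sumX summxE big_mkord; apply: eq_bigr => m _.
  by rewrite mxE iterE emb_crest -surjective_pairing expX Sr.
(* Off the block only the term [m = 0] survives, and it is present as soon as [n] is at least 1. *)
move=> e e0; exists 1%N => // n /= n1; rewrite sumX big_ltn // big_nat big1.
  by rewrite expX (negPf Sr) (inj_eq enum_val_inj) invr1 mul1r addr0 subrr normr0.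
by move=> [//|m] _; rewrite expX (negPf Sr) mulr0.
Qed.

(** The series at [Ltr b k A] converges to [Ldet b k E]; dividing by the series of the proper
    subsets, known by induction, leaves the one at [tauL A b k]. *)
Lemma exp_piL A E G : wfL A -> is_expL A E -> is_factorization ord E G ->
  forall b k, cvg_seq (exp_sum (tauL A b k)) (piL G b k).
Proof.
move=> wA AE fE; elim/proper_set_ind => b IH k.
have := exp_Ldet b k AE; rewrite (Ltr_split p0) // => h.
rewrite -[piL G b k](mulfK (prod_piL_neq0 b k fE)) -(Ldet_split p0 _ _ hord fE).
apply: exp_sum_cancelr h _; first exact: prod_piL_neq0 fE.
by apply: exp_sum_sum => a ab; apply: exp_sum_sum => y _; exact: IH.
Qed.

End TauPi.

(** * The properties of the trace and the determinant *)

Theorem theorem2 (R : realType) (N M p : nat)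
  (hN : (0 < N)%N) (hM : (0 < M)%N) (hp : (0 < p)%N)
  (ord : seq {set 'I_N}) (hord : valid_order ord) :
  (* linearity of tau *)
  (forall (lam mu : R[i]) (A B : Lfam R N M p), wfL A -> wfL B ->
     forall a k, tauL (addL (scaleL lam A) (scaleL mu B)) a k
                 = lam * tauL A a k + mu * tauL B a k) /\
  (* tau(AB) = tau(BA) *)
  (forall A B P Q : Lfam R N M p, wfL A -> wfL B -> wfL P -> wfL Q ->
     (forall q, (0 < q)%N -> forall (u : vfun R N M p q) g,
        @opL R N M p q P u g = @opL R N M p q A (@opL R N M p q B u) g) ->
     (forall q, (0 < q)%N -> forall (u : vfun R N M p q) g,
        @opL R N M p q Q u g = @opL R N M p q B (@opL R N M p q A u) g) ->
     forall a k, tauL P a k = tauL Q a k) /\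
  (* pi(C D) = pi(C) pi(D) *)
  (forall A B P GA GB GP : Lfam R N M p, invL A -> invL B -> invL P ->
     (forall q, (0 < q)%N -> forall (u : vfun R N M p q) g,
        @opL R N M p q P u g = @opL R N M p q A (@opL R N M p q B u) g) ->
     is_factorization ord A GA -> is_factorization ord B GB ->
     is_factorization ord P GP ->
     forall a k, piL GP a k = piL GA a k * piL GB a k) /\
  (* continuity of tau *)
  (forall A : Lfam R N M p, wfL A -> forall e : R, 0 < e ->
     exists d : R, 0 < d /\ forall B : Lfam R N M p, wfL B ->
       normL (addL B (scaleL (-1) A)) < d ->
       normC (fun a k => tauL B a k - tauL A a k) < e) /\
  (* continuity of pi on Inv(L) *)
  (forall A G : Lfam R N M p, invL A -> is_factorization ord A G ->
     forall e : R, 0 < e ->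
     exists d : R, 0 < d /\ forall B H : Lfam R N M p, invL B ->
       is_factorization ord B H ->
       normL (addL B (scaleL (-1) A)) < d ->
       normC (fun a k => piL H a k - piL G a k) < e) /\
  (* pi(e^A) = e^{tau(A)} *)
  (forall A E G : Lfam R N M p, wfL A -> is_expL A E -> invL E ->
     is_factorization ord E G ->
     forall a k, is_expC (tauL A a k) (piL G a k)) /\
  (* operator norm of tau equals M *)
  ((forall A : Lfam R N M p, wfL A -> normL A <= 1 -> normC (tauL A) <= M%:R) /\
   (forall e : R, 0 < e -> exists A : Lfam R N M p,
      [/\ wfL A, normL A <= 1 & M%:R - e < normC (tauL A)])).
Proof.
split; first by move=> lam mu A B _ _ a k; exact: tauL_linear.
split.
  move=> A B P Q _ _ wP wQ PAB QBA.
  by apply: (tauL_comm hp wP wQ); [exact: PAB | exact: QBA].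
split.
  move=> A B P GA GB GP _ _ _ PAB fA fB fP.
  by apply: (piL_mul hp hord _ fA fB fP); exact: PAB.
split.
  move=> A _ e e0; have [d [d0 hd]] := continuous_tauL hp A e0.
  by exists d; split=> // B _; exact: hd.
split; first by move=> A G _ fA e e0; exact: continuous_piL.
split.
  move=> A E G wA AE _ fE a k; apply/cvgC_tends.
  apply: eq_tends (exp_piL hp hord wA AE fE a k) => n.
  by rewrite /exp_sum big_mkord.
split=> [A _ A1|e e0].
  have M1 : M%:R * normL A <= M%:R :> R by rewrite ler_piMr.
  do 2![apply: bigmax_le => // ? _].
  exact: le_trans (normc_tauL hp A _ _) M1.
exists (@idL R N M p); split; [exact: wf_idL | exact: normL_idL |].
by apply: (lt_le_trans _ (normC_tau_idL R N M hp)); rewrite gtrBl.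
Qed.
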